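(* Let $G$ be an infinite group in which every non-abelian subgroup $H$ satisfies $C_G(H)\le H$. Then the Fitting subgroup of $G$ is abelian.
   Context: The Fitting subgroup of $G$ is the subgroup generated by all nilpotent normal subgroups of $G$. $C_G(H)$ denotes the centralizer of $H$ in $G$. *)

(* Defs.v *)
From Stdlib Require Import List.

Record group := Group {
  carrier :> Type;
  mul : carrier -> carrier -> carrier;
  one : carrier;
  inv : carrier -> carrier;
  mulA : forall x y z, mul x (mul y z) = mul (mul x y) z;
  mul1g : forall x, mul one x = x;
  mulg1 : forall x, mul x one = x;
  mulVg : forall x, mul (inv x) x = one;
  mulgV : forall x, mul x (inv x) = one
}.

Section GroupDefs.
Variable G : group.

Definition gset := G -> Prop.

Definition subset (A B : gset) : Prop := forall x, A x -> B x.

Definition infinite_group : Prop := forall l : list G, exists x : G, ~ In x l.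

Definition is_subgroup (H : gset) : Prop :=
  H (one G) /\ (forall x y, H x -> H y -> H (mul G x y)) /\
  (forall x, H x -> H (inv G x)).

Definition generated (A : gset) : gset :=
  fun x => forall S, is_subgroup S -> subset A S -> S x.

Definition conj (x g : G) : G := mul G (mul G (inv G g) x) g.

Definition is_normal (N : gset) : Prop :=
  is_subgroup N /\ forall g x, N x -> N (conj x g).

Definition commg (x y : G) : G :=
  mul G (mul G (mul G (inv G x) (inv G y)) x) y.

Definition comm_subgroup (A B : gset) : gset :=
  generated (fun z => exists a b, A a /\ B b /\ z = commg a b).

Fixpoint lower_central (H : gset) (n : nat) : gset :=
  match n with
  | O => H
  | S m => comm_subgroup (lower_central H m) H
  end.

Definition nilpotent (H : gset) : Prop :=
  exists n, forall x, lower_central H n x -> x = one G.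

Definition centralizer (H : gset) : gset :=
  fun g => forall h, H h -> mul G g h = mul G h g.

Definition abelian (H : gset) : Prop :=
  forall x y, H x -> H y -> mul G x y = mul G y x.

Definition fitting : gset :=
  generated (fun x => exists N, is_normal N /\ nilpotent N /\ N x).

End GroupDefs.

(* Main.v *)
(** Let [x], [y] be non-commuting elements whose commutator [c] commutes with
    both.  An element centralizing [x] and [y] centralizes the non-abelian
    subgroup [<x^r, y^s>] whenever [c^(rs) <> 1], hence lies in it and has the
    form [x^(ri) y^(sj) c^(rsk)].  Varying [r] and [s] forces first [c], then [x]
    and [y] to have finite order, so that the centralizer of [{x, y}] is finite.

    In a non-abelian nilpotent normal subgroup [N], take [x] in the last term of
    the lower central series not contained in [Z(N)], and [y] in [N] not
    commuting with [x].  Then [Z(N)] and [C_N(x, y)] are finite, hence so is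
    [C_N(y)], and then [N] itself, by descent along the lower central series with
    the maps [g |-> [g, y]].  As [x] and [y] have finitely many conjugates and
    [C_G(x, y)] is finite, [G] is finite.  So nilpotent normal subgroups are
    abelian; a similar count shows that two of them commute elementwise. *)
From Stdlib Require Import List ZArith Lia Classical.
Require Import Defs.

(** * Finite predicates *)

Definition finite {T : Type} (P : T -> Prop) : Prop :=
  exists l : list T, forall x, P x -> In x l.

Lemma finite_subset {T : Type} (P Q : T -> Prop) :
  (forall x, P x -> Q x) -> finite Q -> finite P.
Proof. intros H [l Hl]. exists l. auto. Qed.

Lemma finite_image2 {S T U : Type} (P : S -> Prop) (Q : T -> Prop)
    (f : S -> T -> U) :
  finite P -> finite Q ->
  finite (fun z => exists x y, P x /\ Q y /\ z = f x y).
Proof.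
  intros [l Hl] [l' Hl'].
  exists (map (fun p => f (fst p) (snd p)) (list_prod l l')).
  intros z (x & y & Hx & Hy & ->).
  apply (in_map (fun p => f (fst p) (snd p)) _ (x, y)).
  apply in_prod; auto.
Qed.

Lemma finite_fibres {S T : Type} (P : S -> Prop) (Q : T -> Prop) (f : S -> T) :
  finite Q -> (forall x, P x -> Q (f x)) ->
  (forall t, finite (fun x => P x /\ f x = t)) -> finite P.
Proof.
  intros [l Hl] HPQ Hfib.
  apply (finite_subset _ (fun x => P x /\ In (f x) l)); [now auto|].
  clear HPQ Hl.
  induction l as [|t l [l1 IH]].
  - exists nil. intros x [_ []].
  - destruct (Hfib t) as [l2 H2]. exists (l2 ++ l1).
    intros x [Hx [Ht|Ht]]; apply in_or_app; auto.
Qed.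

(** * Group identities, centralizers and generated subgroups *)

Section Groups.
Variable G : group.

Declare Scope grp_scope.
Local Open Scope grp_scope.
Local Notation "1" := (one G) : grp_scope.
Local Notation "x * y" := (mul G x y) : grp_scope.
Local Notation "x ^-1" := (inv G x) (at level 3, format "x ^-1") : grp_scope.

Lemma mulKg (x y : G) : x^-1 * (x * y) = y.
Proof. now rewrite mulA, mulVg, mul1g. Qed.

Lemma mulVKg (x y : G) : x * (x^-1 * y) = y.
Proof. now rewrite mulA, mulgV, mul1g. Qed.

Lemma mulgI (x y z : G) : x * y = x * z -> y = z.
Proof. intro H. now rewrite <- (mulKg x y), H, mulKg. Qed.

Lemma mulIg (x y z : G) : y * x = z * x -> y = z.
Proof.
  intro H. now rewrite <- (mulg1 G y), <- (mulgV G x), mulA, H, <- mulA, mulgV, mulg1.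
Qed.

Lemma invgK (x : G) : x^-1^-1 = x.
Proof. apply (mulgI x^-1). now rewrite mulgV, mulVg. Qed.

Lemma invMg (x y : G) : (x * y)^-1 = y^-1 * x^-1.
Proof.
  apply (mulgI (x * y)). now rewrite mulgV, <- mulA, mulVKg, mulgV.
Qed.

Lemma invg1 : 1^-1 = 1 :> G.
Proof. now rewrite <- (mulg1 G 1^-1), mulVg. Qed.

Hint Rewrite <- mulA : grp.
Hint Rewrite mulVg mulgV mul1g mulg1 mulKg mulVKg invMg invgK invg1 : grp.
Ltac grp := autorewrite with grp.

Definition comm (x y : G) : Prop := x * y = y * x.

Lemma comm_sym (x y : G) : comm x y -> comm y x.
Proof. unfold comm. auto. Qed.

Lemma comm_commg (x y : G) : commg G x y = 1 <-> comm x y.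
Proof.
  unfold commg, comm. split; intro H.
  - apply (mulgI (x^-1 * y^-1)). rewrite mulA, H. now grp.
  - rewrite <- mulA, H. now grp.
Qed.

Lemma mul_commg (x y : G) : x * y = y * x * commg G x y.
Proof. unfold commg. now grp. Qed.

Lemma centralizer_subgroup (H : gset G) : is_subgroup G (centralizer G H).
Proof.
  repeat split; unfold centralizer.
  - intros h _. now grp.
  - intros x y Hx Hy h Hh. rewrite <- mulA, Hy, mulA, Hx by easy. now grp.
  - intros x Hx h Hh. apply (mulgI x). apply (mulIg x).
    rewrite mulVKg. generalize (Hx h Hh). intro E. grp. easy.
Qed.

Lemma generated_subgroup (A : gset G) : is_subgroup G (generated G A).
Proof.
  repeat split.
  - intros S HS _. apply HS.
  - intros x y Hx Hy S HS HA. apply HS; [apply Hx | apply Hy]; auto.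
  - intros x Hx S HS HA. apply HS. apply Hx; auto.
Qed.

Lemma subset_generated (A : gset G) : subset G A (generated G A).
Proof. intros x Hx S _ HA. auto. Qed.

(** Two centralizer steps: the centralizer of [A] contains [A], hence [x]; so the centralizer of [x]
    contains [A], hence [y]. *)
Lemma generated_abelian (A : gset G) :
  (forall x y, A x -> A y -> comm x y) -> abelian G (generated G A).
Proof.
  intros HA x y Hx Hy.
  assert (Hx' : centralizer G A x).
  { apply Hx; [apply centralizer_subgroup|]. intros a Ha b Hb. now apply HA. }
  symmetry. apply (Hy (centralizer G (fun z => z = x))).
  - apply centralizer_subgroup.
  - intros b Hb h ->. symmetry. now apply Hx'.
  - reflexivity.
Qed.

Lemma commg_subgroup (S : gset G) (x y : G) :
  is_subgroup G S -> S x -> S y -> S (commg G x y).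
Proof. intros (_ & HM & HV) Hx Hy. unfold commg. auto 6. Qed.

(** * Integer powers *)

Definition zpow (x : G) (n : Z) : G :=
  if (0 <=? n)%Z then Nat.iter (Z.to_nat n) (mul G x) 1
  else Nat.iter (Z.to_nat (- n)) (mul G x^-1) 1.
Local Notation "x ^ n" := (zpow x n) : grp_scope.

Lemma zpow0 (x : G) : x ^ 0 = 1.
Proof. reflexivity. Qed.

Lemma zpow_succ (x : G) (n : Z) : x ^ (n + 1) = x * x ^ n.
Proof.
  unfold zpow.
  destruct (Z.leb_spec 0 n) as [Hn|Hn].
  - rewrite (proj2 (Z.leb_le 0 (n + 1))) by lia.
    replace (Z.to_nat (n + 1)) with (S (Z.to_nat n)) by lia. reflexivity.
  - replace (Z.to_nat (- n)) with (S (Z.to_nat (- (n + 1)))) by lia.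
    cbn [Nat.iter nat_rect]. rewrite mulVKg.
    (* The sign test changes only at [n = -1], where both iterations are empty. *)
    destruct (Z.leb_spec 0 (n + 1)); [|reflexivity].
    replace n with (-1)%Z by lia. reflexivity.
Qed.

Lemma zpow_pred (x : G) (n : Z) : x ^ (n - 1) = x^-1 * x ^ n.
Proof.
  replace n with ((n - 1) + 1)%Z at 2 by lia. now rewrite zpow_succ, mulKg.
Qed.

Lemma Z_two_way_ind (P : Z -> Prop) :
  P 0%Z -> (forall n, P n -> P (n + 1)%Z) -> (forall n, P n -> P (n - 1)%Z) ->
  forall n, P n.
Proof.
  intros H0 HS HP. apply Z.peano_ind; [easy| |]; intros n Hn.
  - rewrite <- Z.add_1_r. auto.
  - rewrite <- Z.sub_1_r. auto.
Qed.

Lemma zpow1 (x : G) : x ^ 1 = x.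
Proof. change (x * 1 = x). now grp. Qed.

Lemma zpow_add (x : G) (m n : Z) : x ^ (m + n) = x ^ m * x ^ n.
Proof.
  revert m. apply Z_two_way_ind.
  - now rewrite zpow0, mul1g.
  - intros m IH. replace (m + 1 + n)%Z with (m + n + 1)%Z by lia.
    now rewrite !zpow_succ, IH, mulA.
  - intros m IH. replace (m - 1 + n)%Z with (m + n - 1)%Z by lia.
    now rewrite !zpow_pred, IH, mulA.
Qed.

Lemma zpow_opp (x : G) (n : Z) : x ^ (- n) = (x ^ n)^-1.
Proof.
  apply (mulgI (x ^ n)). now rewrite mulgV, <- zpow_add, Z.add_opp_diag_r.
Qed.

Lemma zpow_sub (x : G) (m n : Z) : x ^ (m - n) = x ^ m * (x ^ n)^-1.
Proof. now rewrite <- zpow_opp, <- zpow_add. Qed.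

Lemma zpow_mul (x : G) (m n : Z) : x ^ (m * n) = (x ^ m) ^ n.
Proof.
  revert n. apply Z_two_way_ind.
  - now rewrite Z.mul_0_r.
  - intros n IH. rewrite zpow_succ, <- IH, <- zpow_add. f_equal. lia.
  - intros n IH. rewrite zpow_pred, <- IH, <- zpow_opp, <- zpow_add. f_equal. lia.
Qed.

Lemma zpow_1l (n : Z) : 1 ^ n = 1.
Proof. now rewrite <- (zpow0 1), <- zpow_mul. Qed.

Lemma subgroup_zpow (S : gset G) (x : G) (n : Z) :
  is_subgroup G S -> S x -> S (x ^ n).
Proof.
  intros (H1 & HM & HV) Hx. revert n. apply Z_two_way_ind; [easy| |]; intros n Hn.
  - rewrite zpow_succ. auto.
  - rewrite zpow_pred. auto.
Qed.

Lemma comm_zpow_l (x y : G) (n : Z) : comm x y -> comm (x ^ n) y.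
Proof.
  intro H.
  apply (subgroup_zpow (centralizer G (fun z => z = y)) x n); [|intros h ->|]; auto.
  apply centralizer_subgroup.
Qed.

Lemma comm_zpow (x y : G) (m n : Z) : comm x y -> comm (x ^ m) (y ^ n).
Proof. intro H. apply comm_zpow_l, comm_sym, comm_zpow_l. now apply comm_sym. Qed.

Lemma comm_mul_l (x y z : G) : comm x z -> comm y z -> comm (x * y) z.
Proof. unfold comm. intros Hx Hy. rewrite <- mulA, Hy, mulA, Hx. now grp. Qed.

Lemma comm_inv_l (x y : G) : comm x y -> comm x^-1 y.
Proof. rewrite <- (zpow1 x) at 2. rewrite <- zpow_opp. apply comm_zpow_l. Qed.

Lemma zpow_mul_comm (x y : G) (n : Z) : comm x y -> (x * y) ^ n = x ^ n * y ^ n.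
Proof.
  intro H. revert n. apply Z_two_way_ind.
  - now rewrite !zpow0, mul1g.
  - intros n IH. rewrite !zpow_succ, IH. grp. f_equal. rewrite !mulA. f_equal.
    symmetry. now apply comm_zpow_l.
  - intros n IH.
    assert (E : comm (x ^ (n - 1)) (y ^ (-1))) by now apply comm_zpow.
    change (y ^ (-1)) with (y^-1 * 1) in E. rewrite mulg1, zpow_pred in E.
    rewrite !zpow_pred, IH.
    transitivity (y^-1 * (x^-1 * x ^ n) * y ^ n); [now grp|].
    rewrite <- E. now grp.
Qed.

(** * Pairs whose commutator commutes with both elements *)

(** Conjugation by [y] is an automorphism sending [x] to [x * c], and powers of [x * c] split. *)
Lemma zpow_mul_zpow_l (x y c : G) (i : Z) :
  x * y = y * x * c -> comm c x -> x ^ i * y = y * x ^ i * c ^ i.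
Proof.
  intros H Hx.
  assert (Hc : y^-1 * x * y = x * c) by (rewrite <- mulA, H; now grp).
  assert (E : (y^-1 * x * y) ^ i = y^-1 * x ^ i * y).
  { clear. revert i. apply Z_two_way_ind.
    - rewrite !zpow0. now grp.
    - intros n IH. rewrite !zpow_succ, IH. now grp.
    - intros n IH. rewrite !zpow_pred, IH. now grp. }
  rewrite Hc, zpow_mul_comm in E by now apply comm_sym.
  rewrite <- mulA, E. now grp.
Qed.

Lemma zpow_mul_zpow (x y c : G) (i j : Z) :
  x * y = y * x * c -> comm c x -> comm c y ->
  x ^ i * y ^ j = y ^ j * x ^ i * c ^ (i * j).
Proof.
  intros H Hx Hy.
  (* Exchanging the roles makes [c ^ (- i)] the commutator of [y] and [x ^ i], so the one-sided
     lemma applies again, now to the exponent of [y]. *)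
  assert (E : y * x ^ i = x ^ i * y * (c ^ i)^-1).
  { rewrite (zpow_mul_zpow_l x y c i H Hx). now grp. }
  rewrite <- zpow_opp in E.
  rewrite (zpow_mul_zpow_l _ _ _ j E).
  - rewrite <- zpow_mul, <- mulA, <- zpow_add.
    replace (_ + _)%Z with 0%Z by lia. now rewrite zpow0, mulg1.
  - now apply comm_zpow_l.
Qed.

Definition pair_set (x y : G) : gset G := fun z => z = x \/ z = y.

(** The normal forms are a subgroup containing [x] and [y], because powers of [c] move freely past
    those of [x] and [y]. *)
Lemma generated_pair_form (x y c : G) :
  x * y = y * x * c -> comm c x -> comm c y ->
  subset G (generated G (pair_set x y))
    (fun z => exists i j k, z = x ^ i * y ^ j * c ^ k).
Proof.
  intros H Hx Hy z Hz.
  apply Hz; clear z Hz.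
  - assert (Hyx : forall i j, y ^ j * x ^ i = x ^ i * y ^ j * c ^ (- (i * j))).
    { intros i j. rewrite (zpow_mul_zpow x y c i j H Hx Hy), zpow_opp. now grp. }
    assert (Hcx : forall k i, c ^ k * x ^ i = x ^ i * c ^ k)
      by (intros; now apply comm_zpow).
    assert (Hcy : forall k i, c ^ k * y ^ i = y ^ i * c ^ k)
      by (intros; now apply comm_zpow).
    repeat split.
    + exists 0%Z, 0%Z, 0%Z. rewrite !zpow0. now grp.
    + intros u v (i & j & k & ->) (i' & j' & k' & ->).
      (* Moving [x ^ i'] left past [y ^ j] costs [c ^ (- (i' * j))]. *)
      exists (i + i')%Z, (j + j')%Z, (- (i' * j) + k + k')%Z.
      rewrite !zpow_add.
      transitivity (x ^ i * y ^ j * (c ^ k * x ^ i') * y ^ j' * c ^ k'); [now grp|].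
      rewrite Hcx.
      transitivity (x ^ i * (y ^ j * x ^ i') * (c ^ k * y ^ j') * c ^ k'); [now grp|].
      rewrite Hyx, Hcy.
      transitivity (x ^ i * x ^ i' * y ^ j * (c ^ (- (i' * j)) * y ^ j') * c ^ k * c ^ k');
        [now grp|].
      rewrite Hcy. now grp.
    + intros u (i & j & k & ->).
      exists (- i)%Z, (- j)%Z, (- (- i * - j) - k)%Z.
      unfold Z.sub. rewrite !invMg, <- !zpow_opp, Hyx, !mulA, Hcx, zpow_add.
      transitivity (x ^ (- i) * (c ^ (- k) * y ^ (- j)) * c ^ (- (- i * - j))); [now grp|].
      rewrite Hcy.
      transitivity (x ^ (- i) * y ^ (- j) * (c ^ (- k) * c ^ (- (- i * - j)))); [now grp|].
      rewrite <- !zpow_add. do 2 f_equal. lia.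
  - intros z [-> | ->].
    + exists 1%Z, 0%Z, 0%Z. rewrite zpow1, !zpow0. now grp.
    + exists 0%Z, 1%Z, 0%Z. rewrite zpow1, !zpow0. now grp.
Qed.

(** * Finite order and finite centralizers from the centralizer hypothesis *)

Hypothesis Hcent : forall H : gset G, is_subgroup G H -> ~ abelian G H ->
  subset G (centralizer G H) H.

(** Such a [z] centralizes the non-abelian subgroup generated by [x] and [y], so lies in it. Solving
    the normal form for [x ^ i] shows that it commutes with [y], whence [c ^ i = 1]; likewise for
    [y ^ j]. *)
Lemma comm_pair_form (x y c : G) :
  x * y = y * x * c -> comm c x -> comm c y -> c <> 1 ->
  forall z, comm z x -> comm z y ->
  exists i j k, z = x ^ i * y ^ j * c ^ k /\ c ^ i = 1 /\ c ^ j = 1.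
Proof.
  intros H Hx Hy Hc z Hzx Hzy.
  destruct (generated_pair_form x y c H Hx Hy z) as (i & j & k & E).
  - apply Hcent.
    + apply generated_subgroup.
    + intro Hab. apply Hc. apply (mulgI (y * x)). rewrite <- H, mulg1.
      apply Hab; apply subset_generated; unfold pair_set; auto.
    + intros h Hh. symmetry.
      apply (Hh (centralizer G (fun w => w = z))).
      * apply centralizer_subgroup.
      * intros w [-> | ->] h' ->; now apply comm_sym.
      * reflexivity.
  - exists i, j, k. split; [easy|].
    assert (Hcx : forall n, comm (c ^ n) x) by (intro; now apply comm_zpow_l).
    assert (Hcy : forall n, comm (c ^ n) y) by (intro; now apply comm_zpow_l).
    split.
    + assert (Hi : comm (x ^ i) y).
      { replace (x ^ i) with (z * (c ^ k)^-1 * (y ^ j)^-1) by (rewrite E; now grp).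
        rewrite <- !zpow_opp.
        repeat apply comm_mul_l; auto. now apply comm_zpow_l. }
      apply (mulgI (y * x ^ i)).
      now rewrite <- (zpow_mul_zpow_l x y c i H Hx), mulg1.
    + assert (Hj : comm (y ^ j) x).
      { replace (y ^ j) with ((x ^ i)^-1 * z * (c ^ k)^-1) by (rewrite E; now grp).
        rewrite <- !zpow_opp.
        repeat apply comm_mul_l; auto. now apply comm_zpow_l. }
      apply (mulgI (y ^ j * x)).
      rewrite mulg1. transitivity (x * y ^ j); [symmetry|easy].
      generalize (zpow_mul_zpow x y c 1 j H Hx Hy). now rewrite zpow1, Z.mul_1_l.
Qed.

Lemma comm_zpow_pair_form (x y c : G) (r : Z) :
  x * y = y * x * c -> comm c x -> comm c y -> c ^ (r * r) <> 1 ->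
  forall z, comm z x -> comm z y ->
  exists i j k, z = x ^ (r * i) * y ^ (r * j) * c ^ (r * r * k) /\
    c ^ (r * r * i) = 1 /\ c ^ (r * r * j) = 1.
Proof.
  intros H Hx Hy Hc z Hzx Hzy.
  destruct (comm_pair_form (x ^ r) (y ^ r) (c ^ (r * r))) with (z := z)
    as (i & j & k & E & Ei & Ej); auto using comm_zpow, comm_sym, comm_zpow_l.
  - now apply zpow_mul_zpow.
  - exists i, j, k. now rewrite !zpow_mul in *.
Qed.

Lemma commutator_finite_order (x y c : G) :
  x * y = y * x * c -> comm c x -> comm c y ->
  exists m, (0 < m)%Z /\ c ^ m = 1.
Proof.
  intros H Hx Hy. apply NNPP. intro Hinf.
  assert (Hord : forall n, c ^ n = 1 -> n = 0%Z).
  { intros n Hn. apply NNPP. intro Hn0. apply Hinf.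
    destruct (Z.lt_trichotomy n 0) as [|[|]]; [exists (- n)%Z|easy|exists n];
      split; try lia; auto.
    now rewrite zpow_opp, Hn, invg1. }
  (* For [z = c] and [r = 2], infinite order forces [i = j = 0], so [c = c ^ (4 * k)], which no
     integer [k] allows. *)
  destruct (comm_zpow_pair_form x y c 2) with (z := c)
    as (i & j & k & E & Ei & Ej); auto.
  - intro E. apply Hord in E. discriminate.
  - apply Hord in Ei, Ej.
    replace (2 * i)%Z with 0%Z in E by lia. replace (2 * j)%Z with 0%Z in E by lia.
    rewrite !zpow0, !mul1g in E.
    assert (E' : c ^ (2 * 2 * k - 1) = 1).
    { rewrite zpow_sub, <- E, zpow1. now grp. }
    apply Hord in E'. lia.
Qed.

(** The exponent is the determinant of the two relations; [b] is eliminated as in Cramer's rule. *)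
Lemma zpow_relations_finite_order (a b : G) (p q r s : Z) :
  a ^ p = b ^ q -> b ^ s = a ^ r -> a ^ (p * s - q * r) = 1.
Proof.
  intros Ha Hb. rewrite zpow_sub, (Z.mul_comm q), !zpow_mul, Ha, <- Hb, <- !zpow_mul.
  rewrite (Z.mul_comm s). apply mulgV.
Qed.

(** The elements [x ^ m] and [y ^ m] centralize the pair. Writing them through [x ^ q] and [y ^ q],
    with [q] prime to [m], gives two relations between them with nonzero determinant. *)
Lemma pair_finite_order (x y c : G) :
  x * y = y * x * c -> comm c x -> comm c y -> c <> 1 ->
  exists M, M <> 0%Z /\ x ^ M = 1 /\ y ^ M = 1.
Proof.
  intros H Hx Hy Hc.
  destruct (commutator_finite_order x y c H Hx Hy) as (m & Hm & Ecm).
  assert (Hcm : forall n, c ^ (m * n) = 1)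
    by (intro; now rewrite zpow_mul, Ecm, zpow_1l).
  (* As [q * q = 1 + m * (m + 2)], taking [q]-th powers of both [x] and [y] leaves the commutator
     equal to [c], hence nontrivial. *)
  set (q := (m + 1)%Z).
  assert (Hcq : forall n, c ^ (q * q * n) = c ^ n).
  { intro n. replace (q * q * n)%Z with (m * ((m + 2) * n) + n)%Z by (unfold q; ring).
    now rewrite zpow_add, Hcm, mul1g. }
  assert (Hcen : forall z, comm z x -> comm z y -> exists i j,
            z ^ m = x ^ (m * (q * i)) * y ^ (m * (q * j))).
  { intros z Hzx Hzy.
    destruct (comm_zpow_pair_form x y c q) with (z := z)
      as (i & j & k & E & Ei & Ej); auto.
    - now rewrite <- (Z.mul_1_r (q * q)), Hcq, zpow1.
    - exists i, j. rewrite E at 1. rewrite Hcq in Ei.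
      rewrite !zpow_mul_comm.
      + rewrite <- !zpow_mul, (Z.mul_comm (_ * k)), Hcm, mulg1.
        now rewrite !(Z.mul_comm m).
      (* The powers of [x] and [y] commute because [c ^ i = 1]. *)
      + unfold comm. rewrite (zpow_mul_zpow x y c _ _ H Hx Hy).
        replace (q * i * (q * j))%Z with (i * (q * q * j))%Z by ring.
        now rewrite (zpow_mul c), Ei, zpow_1l, mulg1.
      + apply comm_mul_l; apply comm_zpow; now apply comm_sym. }
  destruct (Hcen (x ^ m)) as (i & j & Ex).
  { now apply comm_zpow_l. }
  { unfold comm. now rewrite (zpow_mul_zpow_l x y c m H Hx), Ecm, mulg1. }
  destruct (Hcen (y ^ m)) as (k & l & Ey).
  { unfold comm. generalize (zpow_mul_zpow x y c 1 m H Hx Hy).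
    now rewrite zpow1, Z.mul_1_l, Ecm, mulg1. }
  { now apply comm_zpow_l. }
  rewrite !(zpow_mul _ m) in Ex, Ey.
  set (X := x ^ m) in *. set (Y := y ^ m) in *.
  assert (EX : X ^ (m - q * i) = Y ^ (q * j)).
  { replace (m - q * i)%Z with (- (q * i) + m)%Z by ring.
    rewrite zpow_add, Ex, zpow_opp. now grp. }
  assert (EY : Y ^ (m - q * l) = X ^ (q * k)).
  { rewrite zpow_sub, Ey. now grp. }
  set (d := ((m - q * i) * (m - q * l) - q * j * (q * k))%Z).
  exists (m * d)%Z. split; [|split].
  (* Modulo [q] one has [m = -1], so [d] is congruent to [m * m], that is to 1, while [q] is at
     least 2. *)
  - assert (Hd : d <> 0%Z).
    { assert (E : d = (1 + q * (m - 1 - m * l - i * m + q * i * l - q * j * k))%Z)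
        by (unfold d, q; ring).
      intro E0. rewrite E in E0.
      assert (Hq : (q | 1)%Z).
      { exists (- (m - 1 - m * l - i * m + q * i * l - q * j * k))%Z. lia. }
      apply Z.divide_1_r_nonneg in Hq; unfold q in *; lia. }
    intro E. apply Z.mul_eq_0 in E. lia.
  - rewrite zpow_mul. now apply (zpow_relations_finite_order X Y).
  - rewrite zpow_mul. replace d with ((m - q * l) * (m - q * i) - q * k * (q * j))%Z
      by (unfold d; ring).
    now apply (zpow_relations_finite_order Y X).
Qed.

Lemma finite_zpow (x : G) (M : Z) :
  M <> 0%Z -> x ^ M = 1 -> finite (fun z => exists n, z = x ^ n).
Proof.
  intros HM E.
  assert (E' : x ^ Z.abs M = 1).
  { destruct (Z.abs_spec M) as [[_ ->]|[_ ->]]; [easy|].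
    now rewrite zpow_opp, E, invg1. }
  exists (map (fun i => x ^ Z.of_nat i) (seq 0 (Z.to_nat (Z.abs M)))).
  intros z [n ->].
  rewrite (Z.div_mod n (Z.abs M)) by lia.
  rewrite zpow_add, zpow_mul, E', zpow_1l, mul1g.
  assert (Hn : (0 <= n mod Z.abs M < Z.abs M)%Z) by (apply Z.mod_pos_bound; lia).
  apply in_map_iff. exists (Z.to_nat (n mod Z.abs M)). split.
  - now rewrite Z2Nat.id.
  - apply in_seq. lia.
Qed.

Definition comm_pair (x y : G) : gset G := fun z => comm z x /\ comm z y.

(** Every element is a product of powers of [x], [y] and [c], each of finite order. *)
Lemma comm_pair_finite (x y c : G) :
  x * y = y * x * c -> comm c x -> comm c y -> c <> 1 -> finite (comm_pair x y).
Proof.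
  intros H Hx Hy Hc.
  destruct (commutator_finite_order x y c H Hx Hy) as (m & Hm & Em).
  destruct (pair_finite_order x y c H Hx Hy Hc) as (M & HM & Exm & Eym).
  eapply finite_subset; cycle 1.
  - apply (finite_image2 (fun z => exists u v, (exists n, u = x ^ n) /\
             (exists n, v = y ^ n) /\ z = u * v) (fun z => exists n, z = c ^ n)
             (mul G)).
    + apply finite_image2; eapply finite_zpow; eassumption.
    + apply (finite_zpow c m); [lia|easy].
  - intros z [Hzx Hzy].
    destruct (comm_pair_form x y c H Hx Hy Hc z Hzx Hzy) as (i & j & k & -> & _).
    exists (x ^ i * y ^ j), (c ^ k). eauto 10.
Qed.

(** * Counting by cosets of centralizers *)

(** Each nonempty fibre of [f] on [P] lies in a translate of [F]. Below, [f] is built from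
    conjugates or commutators and [F] is contained in a centralizer. *)
Lemma finite_cosets {T : Type} (P F : gset G) (Q : T -> Prop) (f : G -> T) :
  finite F -> finite Q -> (forall g, P g -> Q (f g)) ->
  (forall g h, P g -> P h -> f g = f h -> F (g * h^-1)) -> finite P.
Proof.
  intros HF HQ HPQ Hf.
  apply (finite_fibres P Q f HQ HPQ). intro t.
  destruct (classic (exists h, P h /\ f h = t)) as [(h & Hh & <-)|Hno].
  - destruct HF as [l Hl]. exists (map (fun z => z * h) l).
    intros g [Hg Hgh]. apply in_map_iff. exists (g * h^-1). split; [now grp|auto].
  - exists nil. intros g Hg. apply Hno. now exists g.
Qed.

Lemma conj_eq_comm (g h x : G) : conj G x g = conj G x h -> comm (g * h^-1) x.
Proof.
  unfold conj, comm. intro E.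
  apply (f_equal (fun w => g * w * h^-1)) in E. autorewrite with grp in E |- *. now symmetry.
Qed.

Lemma commg_eq_comm_l (g h y : G) :
  commg G g y = commg G h y -> comm (g * h^-1) y.
Proof.
  intro E. apply comm_sym. rewrite <- (invgK y). apply comm_inv_l, comm_sym.
  (* The commutator [[g, y]] is the conjugate of [y^-1] by [g], times [y]. *)
  apply conj_eq_comm. apply (mulIg y). exact E.
Qed.

Lemma commg_eq_comm_r (g h x : G) :
  commg G x g = commg G x h -> comm (g * h^-1) x.
Proof.
  intro E. apply conj_eq_comm. apply (mulgI x^-1).
  unfold commg, conj in *. now rewrite !mulA.
Qed.

(** By normality the pair of conjugates of [x] and [y] by [g] takes finitely many values, and it
    determines [g] up to the centralizer of the pair. *)
Lemma normal_pair_finite (A B : gset G) (x y : G) :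
  is_normal G A -> is_normal G B -> A x -> B y -> finite A -> finite B ->
  finite (comm_pair x y) -> finite (fun _ : G => True).
Proof.
  intros [_ HA] [_ HB] Hx Hy HfA HfB HF.
  apply (finite_cosets _ _ (fun p => exists a b, A a /\ B b /\ p = (a, b))
           (fun g => (conj G x g, conj G y g)) HF).
  - now apply finite_image2.
  - intros g _. exists (conj G x g), (conj G y g). auto.
  - intros g h _ _ E. injection E as E1 E2. split; now apply conj_eq_comm.
Qed.

(** * Nilpotent normal subgroups *)

Lemma lower_central_subset (N : gset G) (n : nat) :
  is_subgroup G N -> subset G (lower_central G N n) N.
Proof.
  intro HN. induction n as [|n IH]; simpl; [now intro|].
  intros z Hz. apply Hz; [easy|].
  intros w (a & b & Ha & Hb & ->). apply commg_subgroup; auto.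
Qed.

Lemma lower_central_commg (N : gset G) (n : nat) (x y : G) :
  lower_central G N n x -> N y -> lower_central G N (S n) (commg G x y).
Proof. intros Hx Hy. apply subset_generated. eauto. Qed.

(** Finiteness climbs from the trivial term to [N]: the map sending [g] to [[g, y]] takes each term
    into the next, with fibres in cosets of the centralizer of [y] in [N]. *)
Lemma nilpotent_finite (N : gset G) (y : G) :
  is_subgroup G N -> nilpotent G N -> N y ->
  finite (fun g => N g /\ comm g y) -> finite N.
Proof.
  intros HN [n Hn] Hy HC.
  assert (Hfin : finite (lower_central G N n)).
  { exists (1 :: nil). intros x Hx. left. symmetry. auto. }
  clear Hn. change (finite (lower_central G N 0)).
  induction n as [|n IH]; [easy|]. apply IH.
  apply (finite_cosets _ _ _ (fun g => commg G g y) HC Hfin).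
  - intros g Hg. now apply lower_central_commg.
  - intros g h Hg Hh E. split; [|now apply commg_eq_comm_l].
    apply HN; [|apply HN]; eapply lower_central_subset; eauto.
Qed.

(** If no such pair exists, a term of the series centralizes [N] as soon as the next one does.
    Starting from the trivial term, this reaches [N] itself. *)
Lemma nilpotent_commutator (N : gset G) :
  nilpotent G N -> is_subgroup G N -> ~ abelian G N ->
  exists x y, N x /\ N y /\ ~ comm x y /\
    forall g, N g -> N (commg G x g) /\ centralizer G N (commg G x g).
Proof.
  intros [n Hn] HN Hab. apply NNPP. intro Hno. apply Hab.
  assert (Hk : subset G (lower_central G N n) (centralizer G N)).
  { intros x Hx h _. rewrite (Hn x Hx). now grp. }
  clear Hn. induction n as [|n IH].
  - intros x y Hx Hy. now apply Hk.
  - apply IH. intros x Hx y Hy. apply NNPP. intro Hxy. apply Hno.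
    exists x, y. repeat split; auto.
    + eapply lower_central_subset; eauto.
    + apply (lower_central_subset N (S n) HN). now apply lower_central_commg.
    + apply Hk. now apply lower_central_commg.
Qed.

Lemma normal_nilpotent_abelian (N : gset G) :
  infinite_group G -> is_normal G N -> nilpotent G N -> abelian G N.
Proof.
  intros Hinf HN Hnil. apply NNPP. intro Hab.
  destruct (nilpotent_commutator N Hnil (proj1 HN) Hab)
    as (x & y & Hx & Hy & Hxy & Hz).
  assert (HF : finite (comm_pair x y)).
  { apply (comm_pair_finite x y (commg G x y)).
    - apply mul_commg.
    - now apply Hz.
    - now apply Hz.
    - now rewrite comm_commg. }
  assert (HZ : finite (fun z => N z /\ centralizer G N z)).
  { apply (finite_subset _ (comm_pair x y)); [|easy].
    intros z [_ Hzz]. split; now apply Hzz. }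
  assert (HfN : finite N).
  { apply (nilpotent_finite N y (proj1 HN) Hnil Hy).
    (* On the centralizer of [y] in [N], the map sending [g] to [[x, g]] has values in the finite
       center of [N] and fibres in cosets of [comm_pair x y]. *)
    apply (finite_cosets _ _ _ (fun g => commg G x g) HF HZ).
    - intros g [Hg _]. now apply Hz.
    - intros g h [_ Hgy] [_ Hhy] E. split.
      + now apply commg_eq_comm_r.
      + apply comm_mul_l; [easy|]. now apply comm_inv_l. }
  destruct (normal_pair_finite N N x y HN HN Hx Hy HfN HfN HF) as [l Hl].
  destruct (Hinf l) as [g Hg]. auto.
Qed.

(** By normality [[a, b]] lies in both [A] and [B], so it commutes with [a] and [b]. The
    intersection of [A] and [B] lies in the finite centralizer of the pair, and commutators with [b]
    and with [a] bound [A] and [B] in turn. *)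
Lemma normal_abelian_comm (A B : gset G) (a b : G) :
  infinite_group G -> is_normal G A -> is_normal G B ->
  abelian G A -> abelian G B -> A a -> B b -> comm a b.
Proof.
  intros Hinf HA HB HabA HabB Ha Hb. apply NNPP. intro Hab.
  assert (Hcomm : forall g h, A g -> B h -> A (commg G g h) /\ B (commg G g h)).
  { intros g h Hg Hh. destruct HA as [SA NA], HB as [SB NB]. split.
    - replace (commg G g h) with (g^-1 * conj G g h) by (unfold commg, conj; now grp).
      apply SA; [apply SA|]; auto.
    - replace (commg G g h) with (conj G h^-1 g * h) by (unfold commg, conj; now grp).
      apply SB; [apply NB; apply SB|]; auto. }
  assert (HF : finite (comm_pair a b)).
  { destruct (Hcomm a b Ha Hb) as [HcA HcB].
    apply (comm_pair_finite a b (commg G a b)).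
    - apply mul_commg.
    - now apply HabA.
    - now apply HabB.
    - now rewrite comm_commg. }
  assert (HAB : finite (fun z => A z /\ B z)).
  { apply (finite_subset _ (comm_pair a b)); [|easy].
    intros z [HzA HzB]. split; [now apply HabA | now apply HabB]. }
  assert (SA := proj1 HA). assert (SB := proj1 HB).
  assert (HfA : finite A).
  { apply (finite_cosets _ _ _ (fun g => commg G g b) HF HAB).
    - auto.
    (* Commuting with [a] is automatic inside the abelian [A]; equal commutators give commuting with
       [b]. *)
    - intros g h Hg Hh E. split; [|now apply commg_eq_comm_l].
      apply HabA; [apply SA; [|apply SA]|]; auto. }
  assert (HfB : finite B).
  { apply (finite_cosets _ _ _ (fun g => commg G a g) HF HAB).
    - auto.
    - intros g h Hg Hh E. split; [now apply commg_eq_comm_r|].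
      apply HabB; [apply SB; [|apply SB]|]; auto. }
  destruct (normal_pair_finite A B a b HA HB Ha Hb HfA HfB HF) as [l Hl].
  destruct (Hinf l) as [g Hg]. auto.
Qed.

End Groups.

Theorem theorem5p1 (G : group) (Hinf : infinite_group G)
  (Hcent : forall H : gset G, is_subgroup G H -> ~ abelian G H ->
             subset G (centralizer G H) H) :
  abelian G (fitting G).
Proof.
  (* It suffices that elements of any two nilpotent normal subgroups commute. *)
  apply generated_abelian.
  intros x y (A & HA & HnA & Hx) (B & HB & HnB & Hy).
  apply (normal_abelian_comm G Hcent A B); auto.
  - now apply (normal_nilpotent_abelian G Hcent).
  - now apply (normal_nilpotent_abelian G Hcent).
Qed.
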